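(* Let $B=(b_{ji})$ be a real $m\times n$ matrix with $\sum_j b_{ji}^2\le 1$ for every column $i$, and run the algorithm described in the context. Fix a row $j$ and let $D_T(r_j)=\sum_{i=1}^n b_{ji}x_T(i)$ be its signed discrepancy after time step $T$. Then for every $\lambda\ge 0$, \[ \Pr\left[|D_T(r_j)|\ge\lambda\right]\le 8\exp\!\left(-\lambda^2/(1000a)\right). \]
   Context: Algorithm. Parameters: $a=6$, $\gamma=1/n^6$, $T=(12/\gamma^2)\log n$. Initialize $x_0=0\in\mathbb{R}^n$ and $A_1=\{1,\dots,n\}$. For $k=1,\dots,T$: call row $j$ big at time $k$ if $\sum_{i\in A_k}b_{ji}^2>a$ and small otherwise. Compute an optimal solution $(u_i^k)_{i\in A_k}$, $u_i^k\in\mathbb{R}^n$, of the semidefinite program: maximize $\sum_{i\in A_k}\|u_i\|_2^2$ subject to (i) $\|\sum_{i\in A_k}b_{ji}u_i\|_2^2=0$ for each big row $j$; (ii) for each small row $j$ and each $\lambda>0$: $\|\sum_{i\in A_k,|b_{ji}|\le 4a/\lambda}b_{ji}u_i\|_2^2\le 2\sum_{i\in A_k,|b_{ji}|\le 4a/\lambda}b_{ji}^2\|u_i\|_2^2$ and $\|\sum_{i\in A_k,|b_{ji}|\le 4a/\lambda}b_{ji}^2x_{k-1}(i)u_i\|_2^2\le 2\sum_{i\in A_k,|b_{ji}|\le 4a/\lambda}b_{ji}^4\|u_i\|_2^2$ (only finitely many distinct constraints arise); (iii) $\|u_i\|_2^2\le 1$ for $i\in A_k$. Draw $r_k\in\{-1,1\}^n$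 with independent uniformly random coordinates. Set $x_k(i)=x_{k-1}(i)+\gamma\langle r_k,u_i^k\rangle$ for $i\in A_k$ and $x_k(i)=x_{k-1}(i)$ otherwise. Set $A_{k+1}=A_k\setminus\{i:|x_k(i)|\ge 1-1/n\}$. The vector $x_T$ is the fractional coloring after step $T$. *)

(* Defs.v *)
From mathcomp Require Import all_boot all_order all_algebra.
From mathcomp Require Import all_classical all_reals all_analysis.
Set Implicit Arguments.
Unset Strict Implicit.
Unset Printing Implicit Defensive.
Import Order.TTheory GRing.Theory Num.Theory.
Local Open Scope ring_scope.

Definition thr {R : realType} : R := 6.

Definition gam (R : realType) (n : nat) : R := 1 / n%:R ^+ 6.

(* [12 / gamma^2 * log n] need not be an integer; the steps k = 1, .., T are
   the positive integers k <= T, so their number is the integer part. *)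
Definition nsteps (R : realType) (n : nat) : nat :=
  Num.truncn (12 / gam R n ^+ 2 * ln n%:R).

(* Euclidean, unlike the library norm on matrices, which is the sup norm. *)
Definition dot (R : realType) (n : nat) (u v : 'rV[R]_n) : R :=
  \sum_l u 0 l * v 0 l.

Definition sqnorm (R : realType) (n : nat) (u : 'rV[R]_n) : R := dot u u.

Section Algorithm.
Variables (R : realType) (m n : nat) (B : 'M[R]_(m, n)).

Definition big_row (A : {set 'I_n}) (j : 'I_m) : bool :=
  thr < \sum_(i in A) B j i ^+ 2.

(* Only the vectors [u i] with [i \in A] are constrained. *)
Definition sdp_feasible (A : {set 'I_n}) (x : 'rV[R]_n)
    (u : 'I_n -> 'rV[R]_n) : Prop :=
  [/\ forall j, big_row A j -> sqnorm (\sum_(i in A) B j i *: u i) = 0,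
      forall j (lambda : R), ~~ big_row A j -> 0 < lambda ->
        sqnorm (\sum_(i in A | `|B j i| <= 4 * thr / lambda) B j i *: u i)
          <= 2 * \sum_(i in A | `|B j i| <= 4 * thr / lambda)
                   B j i ^+ 2 * sqnorm (u i)
        /\
        sqnorm (\sum_(i in A | `|B j i| <= 4 * thr / lambda)
                  (B j i ^+ 2 * x 0 i) *: u i)
          <= 2 * \sum_(i in A | `|B j i| <= 4 * thr / lambda)
                   B j i ^+ 4 * sqnorm (u i)
    & forall i, i \in A -> sqnorm (u i) <= 1].

Definition sdp_value (A : {set 'I_n}) (u : 'I_n -> 'rV[R]_n) : R :=
  \sum_(i in A) sqnorm (u i).

Definition sdp_optimal (A : {set 'I_n}) (x : 'rV[R]_n)
    (u : 'I_n -> 'rV[R]_n) : Prop :=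
  sdp_feasible A x u /\
  forall v, sdp_feasible A x v -> sdp_value A v <= sdp_value A u.

Definition signs : finType := {ffun 'I_n -> bool}.

Definition sign_vec (r : signs) : 'rV[R]_n := \row_i (-1) ^+ r i.

(* From (x_{k-1}, A_k) to (x_k, A_{k+1}), with u = u^k and r = r_k. *)
Definition step (s : 'rV[R]_n * {set 'I_n}) (u : 'I_n -> 'rV[R]_n)
    (r : signs) : 'rV[R]_n * {set 'I_n} :=
  let x' := \row_i (if i \in s.2
                    then s.1 0 i + gam R n * dot (sign_vec r) (u i)
                    else s.1 0 i) in
  (x', s.2 :\: [set i | 1 - 1 / n%:R <= `|x' 0 i|]).

(* A history lists the draws made so far, the most recent first:
   after k steps h = [:: r_k; ..; r_1] and [state sel h] is (x_k, A_{k+1}).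
   [sel h] is the SDP solution used at step k + 1; it may depend on all past
   draws, but not on r_{k+1}. *)
Fixpoint state (sel : seq signs -> 'I_n -> 'rV[R]_n) (h : seq signs) :
    'rV[R]_n * {set 'I_n} :=
  if h is r :: h' then step (state sel h') (sel h') r else (0, [set: 'I_n]%SET).

Definition solves_sdp (sel : seq signs -> 'I_n -> 'rV[R]_n) : Prop :=
  forall h : seq signs, (size h < nsteps R n)%N ->
    sdp_optimal (state sel h).2 (state sel h).1 (sel h).

Definition disc (j : 'I_m) (x : 'rV[R]_n) : R := \sum_i B j i * x 0 i.

End Algorithm.

(* Uniform probability on a finite type. On [nsteps R n].-tuples of [signs n]
   it makes all coordinates of all r_k independent and uniform. *)
Definition unif_prob (R : realType) (W : finType) (E : pred W) : R :=
  #|E|%:R / #|W|%:R.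

(* Main.v *)
(** Fix [lambda > 0] and call an entry of row [j] light if it is at most
    [4 a / lambda]. The discrepancy of the row does not move while the row is
    big. When it first becomes small, the alive columns satisfy
    [sum b^2 <= a], so from then on the heavy entries contribute at most
    [2 sum |b| <= lambda / 2], and the light entries must account for the other
    [lambda / 2]. Let [D] be the light discrepancy and [Q = sum b^2 x^2] the
    light energy. Since the drift of [Q] is [gamma^2 v] with
    [v = sum b^2 |u|^2], while constraint (ii) bounds the variances of [D] and
    of the linear part of [Q] by [2 gamma^2 v] and
    [8 (4 a / lambda)^2 gamma^2 v], the process [exp (theta D - eta Q)] is a
    supermartingale for [theta] of order [lambda / a] and [eta] of order
    [lambda^2 / a^2]. As [Q <= a], Markov's inequality gives the tail bound for
    [D], and the sign of [theta] selects the side. The step size [gamma] makes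
    the increments of the exponent small, because one may assume
    [lambda <= n]. *)
Require Import Defs.
From mathcomp Require Import all_boot all_order all_algebra.
From mathcomp Require Import all_classical all_reals all_analysis.
From mathcomp Require Import ring lra.
Set Implicit Arguments.
Unset Strict Implicit.
Unset Printing Implicit Defensive.
Import Order.TTheory GRing.Theory Num.Theory.
Local Open Scope ring_scope.

(** * Exponential estimates for one step *)

Lemma expR_le_quadratic (R : realType) (x : R) :
  x <= 1 / 2 -> expR x <= 1 + x + 2 * x ^+ 2.
Proof.
move=> hx; have h1 : 0 < 1 - x by lra.
have h2 : 1 - x <= (expR x)^-1.
  by rewrite -expRN; apply: le_trans (expR_ge1Dx (- x)); lra.
have h3 : expR x <= (1 - x)^-1.
  by rewrite -[expR x]invrK lef_pV2 // posrE // invr_gt0 expR_gt0.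
apply: le_trans h3 _; rewrite -[X in X <= _]mul1r ler_pdivrMr //.
have -> : (1 + x + 2 * x ^+ 2) * (1 - x) = 1 + x ^+ 2 * (1 - 2 * x) by ring.
by rewrite lerDl mulr_ge0 ?sqr_ge0 //; lra.
Qed.

(** Here [F] and [G] are the linear parts of [theta D] and [eta Q], and [H] is the drift. In the
    quadratic bound, [(F - G - H)^2 <= 3 (F^2 + G^2 + H^2)] gives the factor 6, and
    [6 H^2 <= 6/100 H] leaves [94/100 H] to pay for the variances. *)
Lemma sum_expR_le_card (R : realType) (W : finType) (F G H : W -> R) :
  \sum_w F w = 0 -> \sum_w G w = 0 ->
  (forall w, 0 <= H w <= 1 / 100) -> (forall w, F w - G w <= 1 / 2) ->
  6 * (\sum_w F w ^+ 2 + \sum_w G w ^+ 2) <= 94 / 100 * \sum_w H w ->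
  \sum_w expR (F w - G w - H w) <= #|W|%:R.
Proof.
move=> F0 G0 H01 FG h.
have e w : expR (F w - G w - H w) <=
    1 + (F w - G w) + (6 * (F w ^+ 2 + G w ^+ 2) - 94 / 100 * H w).
  have /andP[h0 h1] := H01 w; have := FG w => hFG.
  apply: le_trans (expR_le_quadratic _) _; first by lra.
  have : (F w - G w - H w) ^+ 2 <= 3 * (F w ^+ 2 + G w ^+ 2 + H w ^+ 2).
    rewrite -subr_ge0.
    have -> : 3 * (F w ^+ 2 + G w ^+ 2 + H w ^+ 2) - (F w - G w - H w) ^+ 2
      = (F w + G w) ^+ 2 + (F w + H w) ^+ 2 + (G w - H w) ^+ 2 by ring.
    by rewrite !addr_ge0 ?sqr_ge0.
  have : H w ^+ 2 <= 1 / 100 * H w by rewrite expr2 ler_wpM2r.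
  by lra.
apply: (le_trans (ler_sum _ (fun w _ => e w))).
rewrite big_split big_split /= sumr_const sumrB F0 G0 subr0 addr0 sumrB.
by rewrite -!mulr_sumr big_split /= gerDl subr_le0.
Qed.

(** * Averaging over histories of draws *)

Lemma sum_tuple_cons (V : nmodType) (T : finType) (n : nat)
    (F : seq T -> V) :
  \sum_(w : n.+1.-tuple T) F w = \sum_(w : n.-tuple T) \sum_r F (r :: w).
Proof.
rewrite pair_big /=.
rewrite (reindex (fun p : n.-tuple T * T => [tuple of p.2 :: p.1])) //=.
exists (fun w : n.+1.-tuple T => ([tuple of behead w], thead w)).
- by move=> [w r] _ /=; congr pair; apply: val_inj.
- by move=> w _; rewrite [RHS](tuple_eta w).
Qed.

(** The supermartingale property in unnormalised form: the most recent draw is the head of the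
    history and is averaged out first. *)
Lemma sum_tuple_le (R : realType) (T : finType) (n : nat) (F : seq T -> R) :
  (forall h, (size h < n)%N -> \sum_r F (r :: h) <= #|T|%:R * F h) ->
  \sum_(w : n.-tuple T) F w <= #|T|%:R ^+ n * F [::].
Proof.
elim: n => [|n IH] hF.
  rewrite (bigD1 [tuple]) //= big1 ?addr0 ?expr0 ?mul1r // => w /eqP[].
  exact: tuple0.
rewrite sum_tuple_cons exprS -mulrA.
apply: le_trans (_ : _ <= \sum_(w : n.-tuple T) #|T|%:R * F w) _.
  by apply: ler_sum => w _; apply: hF; rewrite size_tuple.
rewrite -mulr_sumr ler_wpM2l // IH // => h hh; apply: hF; exact: ltnW.
Qed.

Lemma dot_sumZ (R : realType) (n : nat) (I : finType) (P : pred I)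
    (c : I -> R) (r : 'rV[R]_n) (u : I -> 'rV[R]_n) :
  dot r (\sum_(i | P i) c i *: u i) = \sum_(i | P i) c i * dot r (u i).
Proof.
rewrite /dot; under [RHS]eq_bigr do rewrite mulr_sumr.
rewrite exchange_big /=; apply: eq_bigr => l _.
rewrite summxE mulr_sumr; apply: eq_bigr => i _; rewrite mxE; ring.
Qed.

Lemma sqnorm_ge0 (R : realType) (n : nat) (u : 'rV[R]_n) : 0 <= sqnorm u.
Proof. by apply: sumr_ge0 => l _; rewrite -expr2 sqr_ge0. Qed.

Lemma sqnorm_eq0 (R : realType) (n : nat) (u : 'rV[R]_n) :
  sqnorm u = 0 -> u = 0.
Proof.
move=> /eqP; rewrite psumr_eq0 => [/allP h|l _]; last by rewrite -expr2 sqr_ge0.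
apply/rowP => l; rewrite mxE; have := h l; rewrite mem_index_enum => /(_ isT).
by rewrite /= mulf_eq0 orbb => /eqP.
Qed.

Lemma sqnorm_coef_le1 (R : realType) (n : nat) (u : 'rV[R]_n) l :
  sqnorm u <= 1 -> `|u 0 l| <= 1.
Proof.
move=> h; rewrite -(ler_pXn2r (n := 2)) ?nnegrE // expr1n real_normK ?num_real //.
apply: le_trans h; rewrite /sqnorm /dot (bigD1 l) //= -expr2 lerDl.
by apply: sumr_ge0 => k _; rewrite -expr2 sqr_ge0.
Qed.

(** * Moments of random sign vectors *)

Section RandomSigns.
Variables (R : realType) (n : nat).

Definition flip (k : 'I_n) (r : signs n) : signs n :=
  [ffun i => (i == k) (+) r i].

Lemma flipK k : involutive (flip k).
Proof. by move=> r; apply/ffunP => i; rewrite !ffunE addbA addbb. Qed.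

Lemma sum_flip_odd k (f : signs n -> R) :
  (forall r, f (flip k r) = - f r) -> \sum_r f r = 0.
Proof.
move=> hf; have : \sum_r f r = - \sum_r f r.
  rewrite {1}(reindex (flip k)); last first.
    by exists (flip k) => r _; exact: flipK.
  by rewrite /= -sumrN; apply: eq_bigr.
by move: (\sum_r f r) => t; lra.
Qed.

Lemma sign_vec_flip k r i :
  sign_vec R (flip k r) 0 i = (if i == k then -1 else 1) * sign_vec R r 0 i.
Proof.
by rewrite !mxE ffunE; case: (i == k); case: (r i);
  rewrite /= ?expr0 ?expr1 ?mul1r ?mulN1r ?opprK.
Qed.

Lemma sign_vec_sqr (r : signs n) i : sign_vec R r 0 i ^+ 2 = 1.
Proof. by rewrite mxE sqrr_sign. Qed.

Lemma sign_vec_norm (r : signs n) i : `|sign_vec R r 0 i| = 1.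
Proof. by rewrite mxE normr_sign. Qed.

Lemma sum_dot_sign_vec (g : 'rV[R]_n) : \sum_r dot (sign_vec R r) g = 0.
Proof.
rewrite exchange_big /= big1 // => l _; rewrite -mulr_suml.
rewrite (@sum_flip_odd l) ?mul0r // => r.
by rewrite sign_vec_flip eqxx mulN1r.
Qed.

(** The cross terms are odd under flipping a single sign, so only the diagonal survives. *)
Lemma sum_dot_sign_vec_sqr (g : 'rV[R]_n) :
  \sum_r dot (sign_vec R r) g ^+ 2 = #|signs n|%:R * sqnorm g.
Proof.
under eq_bigr do rewrite expr2 {1}/dot mulr_suml.
rewrite exchange_big mulr_sumr /=; apply: eq_bigr => l _.
under eq_bigr do rewrite /dot mulr_sumr.
rewrite exchange_big /= (bigD1 l) //= [X in _ + X]big1 ?addr0 => [|k kl].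
  rewrite mulr_natl -sumr_const; apply: eq_bigr => r _.
  by rewrite mulrACA -expr2 sign_vec_sqr mul1r.
rewrite (@sum_flip_odd l) // => r.
by rewrite !sign_vec_flip eqxx (negPf kl); ring.
Qed.

Lemma dot_sign_vec_le (g : 'rV[R]_n) r :
  sqnorm g <= 1 -> `|dot (sign_vec R r) g| <= n%:R.
Proof.
move=> hg; apply: le_trans (ler_norm_sum _ _ _) _.
rewrite -[leRHS]mulr1 -[n in leRHS]card_ord -sum1_card natr_sum mulr_suml.
apply: ler_sum => l _.
by rewrite normrM sign_vec_norm !mul1r sqnorm_coef_le1.
Qed.

End RandomSigns.

(** * Step size and boundedness of the colouring *)

Lemma gam_ge0 (R : realType) (n : nat) : 0 <= gam R n.
Proof. by rewrite /gam divr_ge0 // exprn_ge0. Qed.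

Lemma gam_exp_le1 (R : realType) (n k : nat) :
  (k <= 6)%N -> gam R n * n%:R ^+ k <= 1.
Proof.
move=> k6; rewrite /gam; case: n => [|n].
  (* For [n = 0] the convention [1 / 0 = 0] makes [gam] vanish. *)
  by rewrite expr0n /= invr0 mulr0 mul0r.
rewrite mulrAC mul1r ler_pdivrMr ?exprn_gt0 ?ltr0n // mul1r.
by rewrite ler_weXn2l // ler1n.
Qed.

Section Potential.
Variables (R : realType) (m n : nat) (B : 'M[R]_(m, n)).
Variable sel : seq (signs n) -> 'I_n -> 'rV[R]_n.
Hypothesis hB : forall i : 'I_n, \sum_(j < m) B j i ^+ 2 <= 1.
Hypothesis hsel : solves_sdp B sel.
Variable j : 'I_m.

Let x h := (state sel h).1.
Let A h := (state sel h).2.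

Lemma entry_le1 i : `|B j i| <= 1.
Proof.
rewrite -(ler_pXn2r (n := 2)) ?nnegrE // expr1n real_normK ?num_real //.
apply: le_trans (hB i); rewrite (bigD1 j) //= lerDl.
by apply: sumr_ge0 => k _; rewrite sqr_ge0.
Qed.

Lemma sel_norm_le1 h i : (size h < nsteps R n)%N -> i \in A h ->
  sqnorm (sel h i) <= 1.
Proof. by move=> /hsel[[_ _ h3] _]; exact: h3. Qed.

Lemma state_cons r h i : x (r :: h) 0 i =
  x h 0 i + (if i \in A h then gam R n * dot (sign_vec R r) (sel h i) else 0).
Proof. by rewrite /x /= mxE; case: ifP; rewrite ?addr0. Qed.

Lemma alive_cons r h : A (r :: h) \subset A h.
Proof. exact: subsetDl. Qed.

(** An alive coordinate keeps distance [1 / n] from the boundary, and one step moves it by at most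
    [gam * n <= 1 / n]; a frozen one no longer moves. *)
Lemma state_bounded h : (size h <= nsteps R n)%N -> forall i,
  `|x h 0 i| <= 1 /\ (i \in A h -> `|x h 0 i| <= 1 - 1 / n%:R).
Proof.
elim: h => [|r h IH] hs i.
  have n0 : 0 < n%:R :> R by rewrite ltr0n; case: (n) i => [[]|].
  rewrite /x /= mxE normr0; split=> // _.
  rewrite subr_ge0 ler_pdivrMr // mul1r ler1n.
  by rewrite -(ltr0n R).
have [xb xA] := IH (ltnW hs) i; split; last first.
  by rewrite /A /= !inE -ltNge => /andP[/ltW + _].
rewrite state_cons; case: ifP => iA; last by rewrite addr0.
have n0 : 0 < n%:R :> R by rewrite ltr0n; case: (n) i {xb xA iA} => [[]|].
apply: le_trans (ler_normD _ _) _; rewrite normrM (ger0_norm (gam_ge0 _ _)).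
have := dot_sign_vec_le r (sel_norm_le1 hs iA).
move=> /(ler_wpM2l (gam_ge0 R n)) h1.
have h2 : gam R n * n%:R <= 1 / n%:R.
  rewrite ler_pdivlMr // -mulrA -expr2; exact: gam_exp_le1.
by have := xA iA; lra.
Qed.

Lemma disc_bounded h : (size h <= nsteps R n)%N -> `|disc B j (x h)| <= n%:R.
Proof.
move=> hs; apply: le_trans (ler_norm_sum _ _ _) _.
rewrite -[n in leRHS]card_ord -sum1_card natr_sum; apply: ler_sum => i _.
rewrite normrM mulr_ile1 // ?entry_le1 //; exact: (state_bounded hs i).1.
Qed.

(** * The exponential supermartingale of row [j] *)

Variables lambda theta eta : R.
Hypothesis lambda_gt0 : 0 < lambda.
Hypothesis lambda_le : lambda <= n%:R.
(* With [a = 6] these are [theta = +/- lambda / (250 a)] and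
   [eta = lambda^2 / (2000 a^2)]; they satisfy the supermartingale condition
   [6 (2 theta^2 + 8 eta^2 (4 a / lambda)^2) <= 0.94 eta], and
   [theta lambda / 2 - eta a >= lambda^2 / (1000 a)]. *)
Hypothesis norm_theta : `|theta| = lambda / (15 * 100).
Hypothesis etaE : eta = lambda ^+ 2 / (240 * 300).

Definition active h (i : 'I_n) : bool :=
  (i \in (state sel h).2) && (`|B j i| <= 4 * thr / lambda).

Definition increment h r : R :=
  theta * (\sum_(i | active h i)
    B j i * ((state sel (r :: h)).1 0 i - (state sel h).1 0 i))
  - eta * (\sum_(i | active h i)
    B j i ^+ 2 * ((state sel (r :: h)).1 0 i ^+ 2 - (state sel h).1 0 i ^+ 2)).

(** Only steps with a small row count: constraint (ii) gives no variance control while the row is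
    big. *)
Fixpoint potential h : R :=
  if h is r :: h' then
    potential h' + (if big_row B (state sel h').2 j then 0 else increment h' r)
  else 0.

Let W h := \sum_(i | active h i) B j i *: sel h i.
Let Z h := \sum_(i | active h i) (B j i ^+ 2 * x h 0 i) *: sel h i.

(** Expanding the square of the updated coordinate splits the change of [Q] into a linear part,
    carried by [Z], and a nonnegative quadratic part, the drift. *)
Lemma incrementE h r : increment h r =
  theta * gam R n * dot (sign_vec R r) (W h)
  - 2 * eta * gam R n * dot (sign_vec R r) (Z h)
  - eta * gam R n ^+ 2 * \sum_(i | active h i)
      B j i ^+ 2 * dot (sign_vec R r) (sel h i) ^+ 2.
Proof.
rewrite /increment !dot_sumZ !mulr_sumr -!sumrB; apply: eq_bigr => i.
move=> /andP[iA _]; rewrite -!/(x _) state_cons iA; ring.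
Qed.

Lemma sum_active_le h (F : 'I_n -> R) (c : R) : 0 <= c ->
  (forall i, active h i -> F i <= c) ->
  \sum_(i | active h i) F i <= c * n%:R.
Proof.
move=> c0 hF; rewrite -[n in leRHS]card_ord -sum1_card natr_sum mulr_sumr.
rewrite [leRHS](bigID (active h)) /=; apply: ler_wpDr.
  by apply: sumr_ge0 => i _; rewrite mulr1.
by apply: ler_sum => i hi; rewrite mulr1 hF.
Qed.

Lemma norm_dot_active_le h r (c : 'I_n -> R) : (size h < nsteps R n)%N ->
  (forall i, `|c i| <= 1) ->
  `|dot (sign_vec R r) (\sum_(i | active h i) c i *: sel h i)| <= n%:R ^+ 2.
Proof.
move=> hs hc; rewrite dot_sumZ; apply: le_trans (ler_norm_sum _ _ _) _.
rewrite expr2; apply: sum_active_le => // i /andP[iA _].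
rewrite normrM -[leRHS]mul1r ler_pM //; apply: dot_sign_vec_le.
exact: sel_norm_le1.
Qed.

Lemma sum_expR_increment_le h : (size h < nsteps R n)%N ->
  ~~ big_row B (A h) j ->
  \sum_r expR (increment h r) <= #|signs n|%:R.
Proof.
move=> hs small; under eq_bigr do rewrite incrementE.
have g0 := gam_ge0 R n; set g := gam R n in g0 *.
have eta0 : 0 <= eta by rewrite etaE divr_ge0 // sqr_ge0.
have [[_ hsmall _] _] := hsel hs.
have [hW hZ] := hsmall j lambda small lambda_gt0.
rewrite -/(A h) -/(x h) in hW hZ.
set v := \sum_(i | active h i) B j i ^+ 2 * sqnorm (sel h i).
have v0 : 0 <= v.
  by apply: sumr_ge0 => i _; rewrite mulr_ge0 ?sqr_ge0 ?sqnorm_ge0.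
have {}hW : sqnorm (W h) <= 2 * v by [].
(* On light entries [b^4 <= (4 a / lambda)^2 b^2], and [2 (4 a)^2 = 1152]. *)
have {}hZ : lambda ^+ 2 * sqnorm (Z h) <= 1152 * v.
  have : sqnorm (Z h) <= 2 * ((4 * thr / lambda) ^+ 2 * v).
    apply: le_trans hZ _; rewrite ler_wpM2l // mulr_sumr; apply: ler_sum.
    move=> i /andP[_ hi]; rewrite mulrA ler_wpM2r ?sqnorm_ge0 //.
    rewrite (_ : 4 = 2 + 2)%N // exprD ler_wpM2r ?sqr_ge0 //.
    by rewrite -[B j i ^+ 2]real_normK ?num_real // ler_pXn2r ?nnegrE //;
       exact: le_trans hi.
  rewrite /thr => /(ler_wpM2l (sqr_ge0 lambda)) /le_trans; apply.
  by rewrite le_eqVlt; apply/orP; left; apply/eqP; field; rewrite gt_eqF.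
have n0 : 0 <= n%:R :> R by [].
(* With [lambda <= n], the linear parts are of order [g n^3] and [g n^4], and the drift of order
   [g^2 n^5]. *)
have g4 := @gam_exp_le1 R n 4 isT; have g3 := @gam_exp_le1 R n 3 isT.
have g5 := @gam_exp_le1 R n 5 isT; have g0' := @gam_exp_le1 R n 0 isT.
rewrite -/g in g4 g3 g5 g0'; clearbody g.
apply: sum_expR_le_card.
- by rewrite -mulr_sumr sum_dot_sign_vec mulr0.
- by rewrite -mulr_sumr sum_dot_sign_vec mulr0.
- move=> r; apply/andP; split.
    rewrite mulr_ge0 ?mulr_ge0 ?sqr_ge0 //.
    by apply: sumr_ge0 => i _; rewrite mulr_ge0 ?sqr_ge0.
  have hq : \sum_(i | active h i) B j i ^+ 2 * dot (sign_vec R r) (sel h i) ^+ 2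
      <= n%:R ^+ 2 * n%:R.
    apply: sum_active_le => [|i /andP[iA _]]; first exact: sqr_ge0.
    rewrite -[leRHS]mul1r ler_pM ?sqr_ge0 //.
      by rewrite -[B j i ^+ 2]real_normK ?num_real // expr_le1 ?entry_le1.
    rewrite -[_ ^+ 2]real_normK ?num_real // ler_pXn2r ?nnegrE //.
    by apply: dot_sign_vec_le; exact: sel_norm_le1.
  have gp : 0 <= eta * g ^+ 2 by rewrite mulr_ge0 ?sqr_ge0.
  apply: le_trans (ler_wpM2l gp hq) _.
  have l2 : lambda ^+ 2 <= n%:R ^+ 2 by rewrite ler_pXn2r ?nnegrE // ltW.
  have : lambda ^+ 2 * (g ^+ 2 * n%:R ^+ 3) <= n%:R ^+ 2 * (g ^+ 2 * n%:R ^+ 3).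
    by rewrite ler_wpM2r // mulr_ge0 ?sqr_ge0 ?exprn_ge0.
  have : (g * n%:R ^+ 5) * (g * n%:R ^+ 0) <= 1.
    by rewrite mulr_ile1 // mulr_ge0 // exprn_ge0.
  by rewrite etaE; lra.
- move=> r.
  have /ler_normlP[_ h1] : `|theta * g * dot (sign_vec R r) (W h)| <= 1 / (15 * 100).
    rewrite !normrM norm_theta (ger0_norm g0).
    have := norm_dot_active_le r hs entry_le1; rewrite -/(W h) => hw.
    have hp : 0 <= lambda / (15 * 100) * g by rewrite mulr_ge0 // divr_ge0 // ltW.
    apply: le_trans (ler_wpM2l hp hw) _.
    have : lambda * (g * n%:R ^+ 2) <= n%:R * (g * n%:R ^+ 2).
      by rewrite ler_wpM2r // mulr_ge0 ?sqr_ge0.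
    by lra.
  have /ler_normlP[h2 _] : `|2 * eta * g * dot (sign_vec R r) (Z h)| <= 1 / 100.
    have cz i : `|B j i ^+ 2 * x h 0 i| <= 1.
      rewrite normrM normrX mulr_ile1 ?exprn_ge0 //.
        by rewrite exprn_ile1 ?entry_le1.
      by have [] := state_bounded (ltnW hs) i.
    have := norm_dot_active_le r hs cz; rewrite -/(Z h) => hz.
    have hp : 0 <= 2 * eta * g by rewrite !mulr_ge0.
    rewrite normrM (ger0_norm hp).
    apply: le_trans (ler_wpM2l hp hz) _.
    have l2 : lambda ^+ 2 <= n%:R ^+ 2 by rewrite ler_pXn2r ?nnegrE // ltW.
    have : lambda ^+ 2 * (g * n%:R ^+ 2) <= n%:R ^+ 2 * (g * n%:R ^+ 2).
      by rewrite ler_wpM2r // mulr_ge0 ?sqr_ge0.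
    by rewrite etaE; lra.
  by lra.
- under eq_bigr do rewrite exprMn.
  under [X in _ * (_ + X)]eq_bigr do rewrite exprMn.
  rewrite -!mulr_sumr !sum_dot_sign_vec_sqr exchange_big /=.
  under [X in _ <= _ * (_ * X)]eq_bigr do
    rewrite -mulr_sumr sum_dot_sign_vec_sqr mulrCA.
  rewrite -mulr_sumr -/v.
  set N := #|_|%:R; have N0 : 0 <= N :> R by [].
  rewrite (_ : (theta * g) ^+ 2 = g ^+ 2 * (lambda / (15 * 100)) ^+ 2); last first.
    by rewrite exprMn -[theta ^+ 2]real_normK ?num_real // norm_theta mulrC.
  (* Of the [lambda^4] in [eta^2], one factor [lambda^2] is absorbed by [hZ]; the other is common to
     all terms. *)
  have k0 : 0 <= N * g ^+ 2 * lambda ^+ 2.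
    by rewrite mulr_ge0 ?sqr_ge0 // mulr_ge0 ?sqr_ge0.
  have := ler_wpM2l k0 hW; have := ler_wpM2l k0 hZ.
  have : 0 <= N * g ^+ 2 * lambda ^+ 2 * v by rewrite mulr_ge0.
  by rewrite etaE; lra.
Qed.

Lemma sum_expR_potential_le :
  \sum_(w : (nsteps R n).-tuple (signs n)) expR (potential w)
    <= #|signs n|%:R ^+ nsteps R n.
Proof.
have := @sum_tuple_le R _ (nsteps R n) (fun h => expR (potential h)).
rewrite /= expR0 mulr1; apply=> h hs.
under eq_bigr do rewrite expRD; rewrite -mulr_sumr mulrC.
rewrite ler_wpM2r ?expR_ge0 //.
have [hbig|small] := boolP (big_row B (state sel h).2 j).
  by rewrite expR0 sumr_const lexx.
exact: sum_expR_increment_le.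
Qed.

(** * From the potential back to the discrepancy *)

Let light (A0 : {set 'I_n}) i := (i \in A0) && (`|B j i| <= 4 * thr / lambda).

Lemma sum_activeE h (A0 : {set 'I_n}) (F : 'I_n -> R) : A h \subset A0 ->
  (forall i, i \notin A h -> F i = 0) ->
  \sum_(i | active h i) F i = \sum_(i | light A0 i) F i.
Proof.
move=> /fintype.subsetP sA F0; rewrite big_mkcond [RHS]big_mkcond /=.
apply: eq_bigr => i _; rewrite /active /light -/(A h).
have [iA|iA] := boolP (i \in A h); first by rewrite (sA _ iA).
by rewrite F0 //=; case: ifP.
Qed.

(** Columns outside [A h] are frozen and contribute zero; over a fixed set [A0] the increments of
    successive steps telescope. *)
Lemma increment_wide h r (A0 : {set 'I_n}) : A h \subset A0 ->
  increment h r =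
    theta * (\sum_(i | light A0 i) B j i * (x (r :: h) 0 i - x h 0 i))
    - eta * (\sum_(i | light A0 i)
               B j i ^+ 2 * (x (r :: h) 0 i ^+ 2 - x h 0 i ^+ 2)).
Proof.
move=> sA; rewrite /increment !(sum_activeE sA) // => i iA;
  by rewrite -!/(x _) state_cons (negPf iA) addr0 subrr mulr0.
Qed.

(** Constraint (i) forces the vector sum of [b u] to vanish, and with it the change of the
    discrepancy for every draw. *)
Lemma disc_cons_big h r : (size h < nsteps R n)%N -> big_row B (A h) j ->
  disc B j (x (r :: h)) = disc B j (x h).
Proof.
move=> hs hbig; have [[h1 _ _] _] := hsel hs.
have /sqnorm_eq0 h0 := h1 _ hbig; rewrite -/(A h) in h0.
transitivity (disc B j (x h) + gam R n *
    dot (sign_vec R r) (\sum_(i in A h) B j i *: sel h i)).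
  rewrite dot_sumZ mulr_sumr /disc [X in _ + X]big_mkcond -big_split /=.
  by apply: eq_bigr => i _; rewrite state_cons; case: ifP => _; ring.
by rewrite h0 /dot big1 ?mulr0 ?addr0 // => l _; rewrite [X in _ * X]mxE mulr0.
Qed.

(** Since alive sets only shrink, a small row never becomes big again. *)
Lemma small_row_subset (A1 A0 : {set 'I_n}) : A1 \subset A0 ->
  ~~ big_row B A0 j -> ~~ big_row B A1 j.
Proof.
rewrite /big_row -!leNgt => /fintype.subsetP sA; apply: le_trans.
rewrite big_mkcond [leRHS]big_mkcond /=; apply: ler_sum => i _.
have [iA|_] := boolP (i \in A1); first by rewrite (sA _ iA).
by case: ifP => // _; rewrite sqr_ge0.
Qed.

(* [x0] and [A0] are the colouring and the alive set at the first time at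
   which the row is small. *)
Lemma potentialE h : (size h <= nsteps R n)%N ->
  (disc B j (x h) = 0 /\ potential h = 0) \/
  exists (x0 : 'rV[R]_n) (A0 : {set 'I_n}),
    [/\ A h \subset A0, ~~ big_row B A0 j, disc B j x0 = 0,
        forall i, i \notin A0 -> x h 0 i = x0 0 i
      & forall i, `|x0 0 i| <= 1] /\
    potential h =
      theta * (\sum_(i | light A0 i) B j i * (x h 0 i - x0 0 i))
      - eta * (\sum_(i | light A0 i)
                 B j i ^+ 2 * (x h 0 i ^+ 2 - x0 0 i ^+ 2)).
Proof.
elim: h => [|r h IH] hs.
  by left; split => //; rewrite /disc big1 // => i _; rewrite mxE mulr0.
rewrite /= -/(A h); have [[D0 P0]|] := IH (ltnW hs).
  case: ifPn => [hbig|small].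
    by left; rewrite P0 addr0; split=> //; rewrite disc_cons_big.
  right; exists (x h), (A h); split; last first.
    by rewrite P0 add0r (increment_wide r (subxx _)).
  split=> //; first exact: alive_cons.
    by move=> i iA; rewrite state_cons (negPf iA) addr0.
  by move=> i; have [] := state_bounded (ltnW hs) i.
move=> [x0 [A0 [[sA small D0 out x0b] ->]]].
rewrite (negPf (small_row_subset sA small)); right; exists x0, A0; split.
  split=> //; first exact: fintype.subset_trans (alive_cons _ _) sA.
  move=> i iA0; rewrite state_cons ifN ?addr0 ?out //.
  by apply: contra iA0; apply: (fintype.subsetP sA).
rewrite (increment_wide r sA) !mulr_sumr -!sumrB -big_split /=.
by apply: eq_bigr => i _; ring.
Qed.

Lemma potential_ge h : (size h <= nsteps R n)%N ->
  lambda * `|theta| <= theta * disc B j (x h) ->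
  lambda ^+ 2 / (1000 * thr) <= potential h.
Proof.
move=> hs; rewrite norm_theta; have l2 : 0 < lambda ^+ 2 by rewrite exprn_gt0.
have [[-> _]|[x0 [A0 [[sA small D0 out x0b] ->]]]] := potentialE hs.
  (* A zero discrepancy contradicts the tail hypothesis, as [lambda > 0]. *)
  by lra.
have eta0 : 0 <= eta by rewrite etaE divr_ge0 // sqr_ge0.
have {}small : \sum_(i in A0) B j i ^+ 2 <= 6 by rewrite leNgt.
have -> : disc B j (x h) = \sum_(i in A0) B j i * (x h 0 i - x0 0 i).
  rewrite -[LHS]subr0 -{1}D0 /disc -sumrB [RHS]big_mkcond; apply: eq_bigr => i _.
  by case: ifPn => [_|/out ->]; ring.
rewrite (bigID (fun i => `|B j i| <= 4 * thr / lambda)) /=.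
rewrite -/(light A0).
set SL := \sum_(i | light A0 i) B j i * _.
set HV := \sum_(i in A0 | _) _; set Q := \sum_(i | light A0 i) B j i ^+ 2 * _.
have xb i : `|x h 0 i| <= 1 by have [] := state_bounded hs i.
have hQ : Q <= 6.
  apply: le_trans small; rewrite /Q big_mkcond [leRHS]big_mkcond /=.
  apply: ler_sum => i _; rewrite /light; case: (i \in A0) => //=.
  case: ifP => _; last exact: sqr_ge0.
  rewrite -[leRHS]mulr1 ler_wpM2l ?sqr_ge0 // lerBlDr.
  rewrite -[x h 0 i ^+ 2]real_normK ?num_real // ler_wpDr ?sqr_ge0 //.
  by rewrite exprn_ile1.
(* A heavy entry has [|b| > 24 / lambda], so [2 |b| <= lambda / 12 * b^2], and the squares sum to at
   most 6. *)
have hH : `|HV| <= lambda / 2.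
  apply: le_trans (ler_norm_sum _ _ _) _.
  have : lambda / 12 * (\sum_(i in A0) B j i ^+ 2) <= lambda / 12 * 6.
    by rewrite ler_wpM2l // divr_ge0 // ltW.
  suff : \sum_(i in A0 | ~~ (`|B j i| <= 4 * thr / lambda))
      `|B j i * (x h 0 i - x0 0 i)| <=
      lambda / 12 * (\sum_(i in A0) B j i ^+ 2) by lra.
  rewrite mulr_sumr big_mkcond [leRHS]big_mkcond /=; apply: ler_sum => i _.
  have l12 : 0 <= lambda / 12 by rewrite divr_ge0 // ltW.
  case: (i \in A0) => //=; case: ifPn => [|_]; last by rewrite mulr_ge0 ?sqr_ge0.
  rewrite -ltNge ltr_pdivrMr // /thr => hi.
  have h2 : `|x h 0 i - x0 0 i| <= 2.
    by apply: le_trans (ler_normB _ _) _; have := xb i; have := x0b i; lra.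
  rewrite normrM; apply: le_trans (ler_wpM2l (normr_ge0 _) h2) _.
  have := ler_wpM2l (normr_ge0 (B j i)) (ltW hi).
  by rewrite -[B j i ^+ 2]real_normK ?num_real //; lra.
have hT : theta * HV <= lambda / (15 * 100) * (lambda / 2).
  apply: le_trans (ler_norm _) _; rewrite normrM norm_theta ler_wpM2l //.
  by rewrite divr_ge0 // ltW.
(* The light part leaves [theta * SL >= lambda^2 / 3000], and [eta * Q] costs at most
   [lambda^2 / 12000], which beats the required [lambda^2 / 6000]. *)
have := ler_wpM2l eta0 hQ.
by rewrite mulrDr /thr; rewrite etaE in eta0 *; lra.
Qed.

(** Markov's inequality for [expR (potential w)]. The event is the upper tail for [theta > 0] and
    the lower tail for [theta < 0]. *)
Lemma unif_prob_tail_le :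
  unif_prob R (fun w : (nsteps R n).-tuple (signs n) =>
      lambda * `|theta| <= theta * disc B j (state sel w).1)
    <= expR (- (lambda ^+ 2 / (1000 * thr))).
Proof.
rewrite /unif_prob card_tuple expRN ler_pdivrMr; last first.
  by rewrite ltr0n expn_gt0 card_ffun card_bool expn_gt0.
rewrite [leRHS]mulrC ler_pdivlMr ?expR_gt0 // natrX.
apply: le_trans sum_expR_potential_le.
rewrite -sum1_card natr_sum mulr_suml big_mkcond /=; apply: ler_sum => w _.
rewrite mul1r; case: ifP => [hw|_]; last exact: expR_ge0.
by rewrite ler_expR potential_ge // size_tuple.
Qed.

End Potential.

(** * Combining the two tails *)

Lemma unif_prob_le1 (R : realType) (W : finType) (E : pred W) :
  unif_prob R E <= 1.
Proof.
rewrite /unif_prob; have [->|W0] := posnP #|W|; first by rewrite invr0 mulr0.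
by rewrite ler_pdivrMr ?ltr0n // mul1r ler_nat max_card.
Qed.

Lemma unif_prob_union (R : realType) (W : finType) (E F G : pred W) :
  (forall w, E w -> F w || G w) ->
  unif_prob R E <= unif_prob R F + unif_prob R G.
Proof.
move=> EFG; rewrite /unif_prob -mulrDl ler_wpM2r ?invr_ge0 // -natrD ler_nat.
rewrite -cardUI; apply: leq_trans (leq_addr _ _); apply: subset_leq_card.
by apply/fintype.subsetP => w /EFG.
Qed.

Theorem theorem9 (R : realType) (m n : nat) (B : 'M[R]_(m, n))
    (hB : forall i : 'I_n, \sum_(j < m) B j i ^+ 2 <= 1)
    (sel : seq (signs n) -> 'I_n -> 'rV[R]_n)
    (hsel : solves_sdp B sel)
    (j : 'I_m) (lambda : R) (hlambda : 0 <= lambda) :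
  unif_prob R (fun w : (nsteps R n).-tuple (signs n) =>
                 lambda <= `|disc B j (state sel w).1|)
    <= 8 * expR (- (lambda ^+ 2 / (1000 * thr))).
Proof.
have e0 := expR_ge0 (- (lambda ^+ 2 / (1000 * thr))).
have [l0|lambda_gt0] : lambda = 0 \/ 0 < lambda.
  by move: hlambda; rewrite le_eqVlt => /orP[/eqP<-|]; [left|right].
  apply: le_trans (unif_prob_le1 _ _) _.
  by rewrite l0 expr0n mul0r oppr0 expR0; lra.
(* For [lambda > n] the event is empty, because the discrepancy is at most [n] in absolute value. *)
have [lambda_le|lambda_gt] := leP lambda n%:R; last first.
  rewrite /unif_prob eq_card0 ?mul0r ?mulr_ge0 // => w.
  apply/negbTE; rewrite -ltNge; apply: le_lt_trans lambda_gt.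
  by apply: disc_bounded; rewrite ?size_tuple.
have t0 : 0 < lambda / (15 * 100) by rewrite divr_gt0.
have norm_t := ger0_norm (ltW t0).
have norm_Nt : `|- (lambda / (15 * 100))| = lambda / (15 * 100).
  by rewrite normrN.
have h1 := unif_prob_tail_le hB hsel j lambda_gt0 lambda_le norm_t erefl.
have h2 := unif_prob_tail_le hB hsel j lambda_gt0 lambda_le norm_Nt erefl.
apply: le_trans (le_trans (unif_prob_union _ _) (lerD h1 h2)) _; last by lra.
move=> w /=; rewrite norm_t norm_Nt mulNr -mulrN ![lambda / _ * _]mulrC.
by rewrite !ler_pM2r // ler_normr.
Qed.
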